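(* Whether a HyperLTL formula $\varphi$ expresses a $k$-safety hyperproperty is undecidable in general: there is no algorithm that, given a HyperLTL formula $\varphi$ (and $k \in \mathbb{N}$), decides whether $\mathcal{L}(\varphi)$ is a $k$-safety hyperproperty.
   Context: HyperLTL formulas over a set of atomic propositions AP are generated by $\psi ::= \exists\pi.\psi \mid \forall\pi.\psi \mid \phi$, $\phi ::= a_\pi \mid \neg\phi \mid \phi\vee\phi \mid \bigcirc\phi \mid \phi\,\mathcal{U}\,\phi$, interpreted over sets $T \subseteq \Sigma^\omega$, $\Sigma = 2^{\mathrm{AP}}$, with the standard semantics (quantifiers range over $T$, $a_\pi$ holds iff $a$ is in the current letter of the trace bound to $\pi$, temporal operators shift all bound traces synchronously); $\mathcal{L}(\varphi)$ is the set of trace sets satisfying $\varphi$. For finite $T \subseteq \Sigma^*$ and $T' \subseteq \Sigma^\omega$, $T \le T'$ means every $t \in T$ is a prefix of some $t' \in T'$. For a hyperproperty $\mathbf{S} \subseteq \mathcal{P}(\Sigma^\omega)$, $\mathrm{Bad}(\mathbf{S}) = \{T \subseteq \Sigma^* \text{ finite} \mid \forall T' \subseteq \Sigma^\omega.\ T \le T' \Rightarrow T' \notin \mathbf{S}\}$, and $\mathbf{S}$ is a $k$-safety hyperproperty if every $T' \notin \mathbf{S}$ has some $T \in \mathrm{Bad}(\mathbf{S})$ with $|T| \le k$ and $T \le T'$. *)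

(* Defs.v *)
From mathcomp Require Import all_boot.
Set Implicit Arguments. Unset Strict Implicit. Unset Printing Implicit Defensive.

Inductive ltl : Type :=
| LAtom  (a pi : nat)
| LNeg   (p : ltl)
| LOr    (p q : ltl)
| LNext  (p : ltl)
| LUntil (p q : ltl).

Inductive hltl : Type :=
| HEx   (pi : nat) (h : hltl)
| HAll  (pi : nat) (h : hltl)
| HBody (p : ltl).

Definition letter (n : nat) := {set 'I_n}.
Definition trace (n : nat) := nat -> letter n.
Definition ftrace (n : nat) := seq (letter n).
Definition traceset (n : nat) := trace n -> Prop.
Definition hyperprop (n : nat) := traceset n -> Prop.

Definition env (n : nat) := nat -> option (trace n).

Definition upd n (e : env n) (pi : nat) (t : trace n) : env n :=
  fun x => if x == pi then Some t else e x.

Fixpoint sat_ltl n (e : env n) (i : nat) (p : ltl) : Prop :=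
  match p with
  | LAtom a pi => match e pi with
                  | Some t => [exists j : 'I_n, (val j == a) && (j \in t i)]
                  | None => False
                  end
  | LNeg q => ~ sat_ltl e i q
  | LOr q r => sat_ltl e i q \/ sat_ltl e i r
  | LNext q => sat_ltl e i.+1 q
  | LUntil q r => exists j, i <= j /\ sat_ltl e j r /\
                    forall l, i <= l -> l < j -> sat_ltl e l q
  end.

Fixpoint sat_hltl n (T : traceset n) (e : env n) (h : hltl) : Prop :=
  match h with
  | HEx pi h' => exists t, T t /\ sat_hltl T (upd e pi t) h'
  | HAll pi h' => forall t, T t -> sat_hltl T (upd e pi t) h'
  | HBody p => sat_ltl e 0 p
  end.

Definition hlang n (h : hltl) : hyperprop n :=
  fun T => sat_hltl T (fun _ => None) h.

Fixpoint ltl_ok (n : nat) (bound : seq nat) (p : ltl) : bool :=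
  match p with
  | LAtom a pi => (a < n) && (pi \in bound)
  | LNeg q | LNext q => ltl_ok n bound q
  | LOr q r | LUntil q r => ltl_ok n bound q && ltl_ok n bound r
  end.

Fixpoint hltl_ok (n : nat) (bound : seq nat) (h : hltl) : bool :=
  match h with
  | HEx pi h' | HAll pi h' => hltl_ok n (pi :: bound) h'
  | HBody p => ltl_ok n bound p
  end.

Definition closed_over (n : nat) (h : hltl) : bool := hltl_ok n [::] h.

(* Bad prefixes and k-safety.  Finite sets of finite traces are        *)
(* represented by sequences; their cardinality is size (undup T).      *)

Definition is_prefix n (u : ftrace n) (t : trace n) : Prop :=
  u = mkseq t (size u).

Definition fin_le n (T : seq (ftrace n)) (T' : traceset n) : Prop :=
  forall u, u \in T -> exists t, T' t /\ is_prefix u t.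

Definition Bad n (S : hyperprop n) (T : seq (ftrace n)) : Prop :=
  forall T' : traceset n, fin_le T T' -> ~ S T'.

Definition k_safety n (k : nat) (S : hyperprop n) : Prop :=
  forall T' : traceset n, ~ S T' ->
    exists T : seq (ftrace n), Bad S T /\ size (undup T) <= k /\ fin_le T T'.

Inductive prf : Type :=
| PZero
| PSucc
| PProj (i : nat)
| PComp (f : prf) (gs : list prf)
| PRec  (f g : prf)
| PMu   (f : prf).

Inductive prf_eval : prf -> seq nat -> nat -> Prop :=
| ev_zero v : prf_eval PZero v 0
| ev_succ x v : prf_eval PSucc (x :: v) x.+1
| ev_proj i v : i < size v -> prf_eval (PProj i) v (nth 0 v i)
| ev_comp f gs v ws y :
    prf_evals gs v ws -> prf_eval f ws y -> prf_eval (PComp f gs) v y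
| ev_rec0 f g v y : prf_eval f v y -> prf_eval (PRec f g) (0 :: v) y
| ev_recS f g m v r y :
    prf_eval (PRec f g) (m :: v) r -> prf_eval g (m :: r :: v) y ->
    prf_eval (PRec f g) (m.+1 :: v) y
| ev_mu f v m :
    prf_eval f (m :: v) 0 ->
    (forall l, l < m -> exists r, prf_eval f (l :: v) r.+1) ->
    prf_eval (PMu f) v m
with prf_evals : list prf -> seq nat -> seq nat -> Prop :=
| evs_nil v : prf_evals nil v [::]
| evs_cons g gs v w ws :
    prf_eval g v w -> prf_evals gs v ws -> prf_evals (g :: gs) v (w :: ws).

Definition cpair (x y : nat) : nat := (x + y) * (x + y).+1 %/ 2 + y.

Fixpoint enc_ltl (p : ltl) : nat :=
  match p with
  | LAtom a pi => cpair 0 (cpair a pi)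
  | LNeg q => cpair 1 (enc_ltl q)
  | LOr q r => cpair 2 (cpair (enc_ltl q) (enc_ltl r))
  | LNext q => cpair 3 (enc_ltl q)
  | LUntil q r => cpair 4 (cpair (enc_ltl q) (enc_ltl r))
  end.

Fixpoint enc_hltl (h : hltl) : nat :=
  match h with
  | HEx pi h' => cpair 0 (cpair pi (enc_hltl h'))
  | HAll pi h' => cpair 1 (cpair pi (enc_hltl h'))
  | HBody p => cpair 2 (enc_ltl p)
  end.

Definition enc_instance (n : nat) (h : hltl) (k : nat) : nat :=
  cpair n (cpair (enc_hltl h) k).

(* Main.v *)
(* For k = 0, a hyperproperty that rejects the empty trace set is 0-safety
   iff it is empty, so it suffices to show that satisfiability is
   undecidable. A trace encodes a fact "f at v evaluates to y" by storing
   each number as the position at which a proposition holds; copying and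
   taking successors are then LTL definable. A formula of shape exists
   forall exists exists states that some trace is the fact "d at (x, y)
   evaluates to 1" and that each trace follows by an evaluation rule from
   two other traces; since these rules descend on the program and on a
   numerical argument, such trace sets contain only true facts. For fixed d
   this formula is built from a fixed LTL formula p and the numbers x and y
   alone, so its code is computable from x, y and the code of p. Given a
   decision procedure f, let d be f composed with that computation, and feed
   d with the data of its own formula: the answer f gives is wrong. No
   coding of programs by numbers is needed, as the formula p itself plays
   that role. *)
From HB Require Import structures.
Require Import Defs.
From mathcomp Require Import all_boot.
From Stdlib Require Import Classical ClassicalEpsilon FunctionalExtensionality.
Set Implicit Arguments. Unset Strict Implicit. Unset Printing Implicit Defensive.

(** * A fragment of LTL on four traces *)

Definition has_at n (t : trace n) (r p : nat) : bool :=
  [exists j : 'I_n, (val j == r) && (j \in t p)].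

Definition env_at n (e : env n) (x r p : nat) : bool :=
  if e x is Some t then has_at t r p else false.

Lemma has_at_oob n (t : trace n) r p : n <= r -> has_at t r p = false.
Proof.
move=> nr; apply/existsP=> -[j /andP[/eqP jr _]].
by move: (ltn_ord j); rewrite -[nat_of_ord j]/(val j) jr ltnNge nr.
Qed.

(** The syntax has no constant for truth. This tautology is closed once [0 < n] and the variable [0]
    is bound. *)
Definition LTop := LOr (LAtom 0 0) (LNeg (LAtom 0 0)).
Definition LAnd p q := LNeg (LOr (LNeg p) (LNeg q)).
Definition LIff p q := LAnd (LOr (LNeg p) q) (LOr (LNeg q) p).
Definition LFin p := LUntil LTop p.
Definition LGlob p := LNeg (LFin (LNeg p)).
Definition LConj n (F : nat -> ltl) := foldr LAnd LTop (map F (iota 0 n)).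

(* Junk atoms are replaced by falsity, so that translated formulas are
   always closed. *)
Definition atm n r x :=
  if (r < n) && (x < 4) then LAtom r x else LNeg LTop.

Section Sat.
Variables (n : nat) (e : env n).
Implicit Types (p q : ltl) (i j : nat).

Lemma sat_top i : sat_ltl e i LTop.
Proof. exact: classic. Qed.

Lemma sat_and i p q :
  sat_ltl e i (LAnd p q) <-> sat_ltl e i p /\ sat_ltl e i q.
Proof.
split=> [/= npq|[hp hq] /= [] //].
by split; apply: NNPP => h; apply: npq; [left|right].
Qed.

Lemma sat_imp i p q :
  sat_ltl e i (LOr (LNeg p) q) <-> (sat_ltl e i p -> sat_ltl e i q).
Proof.
split=> [[np /np|]|pq] //=.
by case: (classic (sat_ltl e i p)) => [/pq|]; [right|left].
Qed.

Lemma sat_iff i p q :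
  sat_ltl e i (LIff p q) <-> (sat_ltl e i p <-> sat_ltl e i q).
Proof. by rewrite sat_and !sat_imp. Qed.

Lemma sat_fin i p :
  sat_ltl e i (LFin p) <-> exists2 j, i <= j & sat_ltl e j p.
Proof.
split=> [[j [ij [hj _]]]|[j ij hj]]; first by exists j.
by exists j; split=> //; split=> // l _ _; apply: sat_top.
Qed.

Lemma sat_glob i p :
  sat_ltl e i (LGlob p) <-> forall j, i <= j -> sat_ltl e j p.
Proof.
have -> : sat_ltl e i (LGlob p) <-> ~ sat_ltl e i (LFin (LNeg p)) by [].
rewrite sat_fin; split=> [h j ij|h [j ij]]; last by apply; apply: h.
by apply: NNPP => nj; apply: h; exists j.
Qed.

Lemma sat_conj i m (F : nat -> ltl) :
  sat_ltl e i (LConj m F) <-> forall j, j < m -> sat_ltl e i (F j).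
Proof.
have -> : (forall j, j < m -> sat_ltl e i (F j)) <->
          (forall j, j \in iota 0 m -> sat_ltl e i (F j)).
  by split=> h j; have := h j; rewrite mem_iota.
rewrite /LConj; elim: (iota 0 m) => [|a s IH] /=.
  by split=> // _; apply: sat_top.
have -> : (~ (~ sat_ltl e i (F a) \/ ~ sat_ltl e i (foldr LAnd LTop (map F s))))
   <-> sat_ltl e i (F a) /\ sat_ltl e i (foldr LAnd LTop (map F s)).
  exact: sat_and.
rewrite IH; split=> [[ha hs] j|h].
  by rewrite inE => /predU1P[->|/hs].
by split=> [|j js]; apply: h; rewrite inE ?eqxx ?js ?orbT.
Qed.

Lemma sat_next i k p : sat_ltl e i (iter k LNext p) <-> sat_ltl e (k + i) p.
Proof. by elim: k i => [|k IH] i //=; rewrite IH addnS. Qed.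

Lemma sat_atom i r x : sat_ltl e i (LAtom r x) <-> env_at e x r i.
Proof. by rewrite /env_at /=; case: (e x). Qed.

Hypothesis e_supp : forall x, 3 < x -> e x = None.

Lemma sat_atm i r x : sat_ltl e i (atm n r x) <-> env_at e x r i.
Proof.
have botE (b : bool) : b = false -> sat_ltl e i (LNeg LTop) <-> b.
  by move=> ->; split=> // /(_ (@sat_top i)).
rewrite /atm; case: ltnP => [_|nr] /=; last first.
  by apply: botE; rewrite /env_at; case: (e x) => // t; rewrite has_at_oob.
case: ltnP => [_|x4]; first exact: sat_atom.
by apply: botE; rewrite /env_at e_supp.
Qed.

End Sat.

(* Register [0] of a trace holds its tag; the others alternate between
   arguments and results. *)
Definition rg (b : bool) (i : nat) := (b + i.*2).+1.
Notation arg := (rg false).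
Notation res := (rg true).

(** Tests read [h x r p] as: register [r] of trace [x] is true at position [p]. They may speak of
    infinitely many registers; the bound [n] enters only in the translation to LTL. *)
Inductive test : Type :=
| TTop
| TEq (r x r' x' : nat)
| TEqs (b : bool) (s x : nat) (b' : bool) (s' x' : nat)
| TNil (b : bool) (s x : nat)
| TSucc (r x r' x' : nat)
| TAt (k r x : nat)
| TOne (r x : nat)
| TNot (c : test)
| TAnd (c c' : test)
| TOr (c c' : test).

Fixpoint test_holds (h : nat -> nat -> nat -> bool) (c : test) : Prop :=
  match c with
  | TTop => True
  | TEq r x r' x' => forall p, h x r p = h x' r' p
  | TEqs b s x b' s' x' =>
      forall i p, h x (rg b (s + i)) p = h x' (rg b' (s' + i)) p
  | TNil b s x => forall i p, h x (rg b (s + i)) p = false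
  | TSucc r x r' x' =>
      forall p, h x r p = if p is p'.+1 then h x' r' p' else false
  | TAt k r x => h x r k
  | TOne r x => exists k, forall p, h x r p = (k == p)
  | TNot c => ~ test_holds h c
  | TAnd c c' => test_holds h c /\ test_holds h c'
  | TOr c c' => test_holds h c \/ test_holds h c'
  end.

Fixpoint ltl_of (n : nat) (c : test) : ltl :=
  match c with
  | TTop => LTop
  | TEq r x r' x' => LGlob (LIff (atm n r x) (atm n r' x'))
  | TEqs b s x b' s' x' => LConj n (fun i =>
      LGlob (LIff (atm n (rg b (s + i)) x) (atm n (rg b' (s' + i)) x')))
  | TNil b s x => LConj n (fun i => LGlob (LNeg (atm n (rg b (s + i)) x)))
  | TSucc r x r' x' =>
      LAnd (LNeg (atm n r x)) (LGlob (LIff (LNext (atm n r x)) (atm n r' x')))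
  | TAt k r x => iter k LNext (atm n r x)
  | TOne r x =>
      LAnd (LFin (atm n r x))
        (LGlob (LOr (LNeg (atm n r x)) (LNext (LGlob (LNeg (atm n r x))))))
  | TNot c => LNeg (ltl_of n c)
  | TAnd c c' => LAnd (ltl_of n c) (ltl_of n c')
  | TOr c c' => LOr (ltl_of n c) (ltl_of n c')
  end.

(** Lets a conjunction over [i < n] express a condition on a whole block: the remaining registers
    lie outside the alphabet and are never true. *)
Lemma rg_oob n b s i : n <= i -> n <= rg b (s + i).
Proof.
move=> ni; rewrite /rg; apply: leqW; apply: leq_trans ni _.
apply: leq_trans (leq_addl s i) _; rewrite -addnn.
exact: leq_trans (leq_addr _ _) (leq_addl _ _).
Qed.

Lemma env_at_oob n (e : env n) x b s i p :
  n <= i -> env_at e x (rg b (s + i)) p = false.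
Proof.
move=> ni; rewrite /env_at; case: (e x) => // t.
by rewrite has_at_oob // rg_oob.
Qed.

Lemma sat_ltl_of n (e : env n) c :
  (forall x, 3 < x -> e x = None) ->
  sat_ltl e 0 (ltl_of n c) <-> test_holds (env_at e) c.
Proof.
move=> e_supp.
have atmE i r x : sat_ltl e i (atm n r x) <-> env_at e x r i by apply: sat_atm.
have eqE (r x r' x' : nat) : sat_ltl e 0 (LGlob (LIff (atm n r x) (atm n r' x')))
    <-> forall p, env_at e x r p = env_at e x' r' p.
  rewrite sat_glob; split=> [h p|h p _]; last by rewrite sat_iff !atmE h.
  by have := h p (leq0n p); rewrite sat_iff !atmE => /Bool.eq_iff_eq_true.
elim: c => [||||||||c IH c' IH'|].
- by split=> // _; apply: sat_top.
- by move=> r x r' x'; rewrite [ltl_of _ _]/= eqE.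
- move=> b s x b' s' x'; rewrite [ltl_of _ _]/= sat_conj.
  split=> [h i|h i _]; last by rewrite eqE; apply: h.
  case: (ltnP i n) => [/h/eqE //|ni] p.
  by rewrite !env_at_oob.
- move=> b s x; rewrite [ltl_of _ _]/= sat_conj; split=> [h i p|h i _].
    case: (ltnP i n) => [/h|/env_at_oob-> //].
    by rewrite sat_glob => /(_ p (leq0n p)) /= /(atmE _ _ _) /negP/negbTE.
  by rewrite sat_glob => p _ /= /(atmE _ _ _); rewrite h.
- move=> r x r' x'; rewrite [ltl_of _ _]/= sat_and sat_glob.
  split=> [[h0 h] [|p]|h].
  + by apply/negP => /atmE.
  + by have := h p (leq0n p); rewrite sat_iff /= !atmE => /Bool.eq_iff_eq_true.
  + split=> [/= /atmE|p _]; first by rewrite h.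
    by rewrite sat_iff /= !atmE h.
- by move=> k r x; rewrite [ltl_of _ _]/= sat_next atmE addn0.
- move=> r x; rewrite [ltl_of _ _]/= sat_and sat_fin sat_glob.
  split=> [[[k _ /atmE hk] h]|[k hk]].
    have after p q : env_at e x r p -> p < q -> env_at e x r q = false.
      move=> /atmE hp pq; have := h p (leq0n p); rewrite sat_imp => /(_ hp).
      rewrite -[sat_ltl _ _ _]/(sat_ltl e p.+1 (LGlob (LNeg (atm n r x)))).
      by rewrite sat_glob => /(_ q pq) /= /(atmE _ _ _) /negP/negbTE.
    exists k => p; case: (ltngtP k p) => [|pk|<-]; [exact: after| |exact: hk].
    (* An earlier occurrence is excluded because it would forbid the one at [k]. *)
    by apply/negP => hp; move: (after _ _ hp pk); rewrite hk.
  split=> [|p _]; first by exists k => //; apply/atmE; rewrite hk.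
  rewrite sat_imp atmE hk => /eqP <-.
  rewrite -[sat_ltl _ _ _]/(sat_ltl e k.+1 (LGlob (LNeg (atm n r x)))).
  by rewrite sat_glob => q kq /= /(atmE _ _ _); rewrite hk ltn_eqF.
- by move=> c IH /=; rewrite IH.
- by rewrite [ltl_of _ _]/= sat_and IH IH'.
- by move=> c IH c' IH' /=; rewrite IH IH'.
Qed.

Lemma ltl_ok_of n c : 0 < n -> ltl_ok n [:: 3; 2; 1; 0] (ltl_of n c).
Proof.
move=> n0.
have okT : ltl_ok n [:: 3; 2; 1; 0] LTop by rewrite /= n0.
have okA r x : ltl_ok n [:: 3; 2; 1; 0] (atm n r x).
  rewrite /atm; case: ifP => //= /andP[-> /=].
  by case: x => [|[|[|[|]]]].
have okC m F : (forall i, ltl_ok n [:: 3; 2; 1; 0] (F i)) ->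
    ltl_ok n [:: 3; 2; 1; 0] (LConj m F).
  by move=> okF; rewrite /LConj; elim: (iota 0 m) => //= i s ->; rewrite okF.
elim: c => /= [||||||||c -> c' ->|c -> c' ->] //.
- by move=> *; rewrite !okA n0.
- by move=> *; apply: okC => i /=; rewrite !okA n0.
- by move=> *; apply: okC => i /=; rewrite !okA n0.
- by move=> *; rewrite !okA n0.
- by move=> k r x; elim: k => //=.
- by move=> *; rewrite !okA n0.
Qed.

(** * Derivations of [prf_eval] as trace sets *)

Section PrfInd.
Variable P : prf -> Prop.
Hypothesis PZ : P PZero.
Hypothesis PS : P PSucc.
Hypothesis PP : forall i, P (PProj i).
Hypothesis PC : forall f gs, P f -> List.Forall P gs -> P (PComp f gs).
Hypothesis PR : forall f g, P f -> P g -> P (PRec f g).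
Hypothesis PM : forall f, P f -> P (PMu f).

Fixpoint prf_nested_ind (f : prf) : P f :=
  match f with
  | PZero => PZ
  | PSucc => PS
  | PProj i => PP i
  | PComp f gs => PC (prf_nested_ind f)
      ((fix all_ind (gs : list prf) : List.Forall P gs :=
          if gs is g :: gs' then
            List.Forall_cons g (prf_nested_ind g) (all_ind gs')
          else List.Forall_nil P) gs)
  | PRec f g => PR (prf_nested_ind f) (prf_nested_ind g)
  | PMu f => PM (prf_nested_ind f)
  end.
End PrfInd.

(** Needed for the final clash between the answers 0 and 1. For [PMu], at the smaller of two
    distinct results the program would be both zero and positive. *)
Lemma prf_eval_det f v y y' : prf_eval f v y -> prf_eval f v y' -> y = y'.
Proof.
elim/prf_nested_ind: f v y y' => [||i|f gs IHf IHgs|f g IHf IHg|f IHf] v y y'.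
- by move=> H1 H2; inversion H1; inversion H2.
- by move=> H1; inversion H1; subst => H2; inversion H2.
- by move=> H1 H2; inversion H1; inversion H2.
- move=> H1 H2; inversion H1 as [| | |? ? ? ws1 ? E1 F1| | |]; subst.
  inversion H2 as [| | |? ? ? ws2 ? E2 F2| | |]; subst.
  suff ws12 : ws1 = ws2 by apply: IHf F1 _; rewrite ws12.
  elim: IHgs ws1 ws2 E1 E2 {F1 F2 H1 H2} => [|g gs' IHg _ IH] ws1 ws2 E1 E2.
    by inversion E1; inversion E2.
  inversion E1 as [|? ? ? w1 ? G1 S1]; inversion E2 as [|? ? ? w2 ? G2 S2].
  by rewrite (IHg _ _ _ G1 G2) (IH _ _ S1 S2).
- case: v => [|m v]; first by move=> H1; inversion H1.
  elim: m y y' => [|m IHm] y y' H1 H2.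
    by inversion H1; inversion H2; subst; apply: IHf; eassumption.
  inversion H1 as [| | | | |? ? ? ? r1 ? R1 G1|]; subst.
  inversion H2 as [| | | | |? ? ? ? r2 ? R2 G2|]; subst.
  by apply: IHg G1 _; rewrite (IHm _ _ R1 R2).
- move=> H1 H2; inversion H1 as [| | | | | |? ? ? Z1 M1]; subst.
  inversion H2 as [| | | | | |? ? ? Z2 M2]; subst.
  case: (ltngtP y y') => [/M2[r]|/M1[r]|//] Er.
    by have := IHf _ _ _ Z1 Er.
  by have := IHf _ _ _ Z2 Er.
Qed.

(* [Below f] at arguments [m :: v] asserts that [f] is positive at [l :: v] for
   all [l < m]: it splits the unboundedly many premises of [ev_mu] into steps
   with two premises each. *)
Inductive node : Type :=
| Ev (f : prf)
| Evs (gs : seq prf)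
| Below (f : prf).

(** Programs are compared classically: the formula for a program is only shown to exist, so its
    construction need not be computable. *)
Definition node_eqb (c c' : node) : bool :=
  if excluded_middle_informative (c = c') then true else false.
Lemma node_eqP : Equality.axiom node_eqb.
Proof.
by move=> c c'; rewrite /node_eqb; case: excluded_middle_informative => h;
  constructor.
Qed.
HB.instance Definition _ := hasDecEq.Build node node_eqP.

Definition kids (c : node) : seq node :=
  match c with
  | Ev (PComp f gs) => [:: Evs gs; Ev f]
  | Ev (PRec f g) => [:: Ev f; Ev (PRec f g); Ev g]
  | Ev (PMu f) => [:: Below f; Ev f]
  | Evs (g :: gs) => [:: Ev g; Evs gs]
  | Below f => [:: Below f; Ev f]
  | _ => [::]
  end.

Definition closed_nodes (L : seq node) :=
  forall c, c \in L -> {subset kids c <= L}.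

Lemma closed_nodes_cat L1 L2 :
  closed_nodes L1 -> closed_nodes L2 -> closed_nodes (L1 ++ L2).
Proof.
move=> cl1 cl2 c; rewrite mem_cat => /orP[/cl1|/cl2] cl c' /cl.
  by rewrite mem_cat => ->.
by rewrite mem_cat orbC => ->.
Qed.

Lemma closed_nodes_cons c L :
  closed_nodes L -> {subset kids c <= c :: L} -> closed_nodes (c :: L).
Proof.
move=> cl kc c'; rewrite inE => /predU1P[-> //|/cl kc' c'' /kc'].
by rewrite inE orbC => ->.
Qed.

(** A derivation for a fixed program visits only finitely many nodes. Hence [rules] is a single
    finite test, and positions in the list can serve as tags. *)
Lemma closed_nodes_ex f : exists2 L, Ev f \in L & closed_nodes L.
Proof.
elim/prf_nested_ind: f => [||i|f gs [Lf fL clf] IHgs|f g|f].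
- by exists [:: Ev PZero]; rewrite ?mem_head //; apply: closed_nodes_cons.
- by exists [:: Ev PSucc]; rewrite ?mem_head //; apply: closed_nodes_cons.
- by exists [:: Ev (PProj i)]; rewrite ?mem_head //; apply: closed_nodes_cons.
- have [Lgs gsL clgs] : exists2 L, Evs gs \in L & closed_nodes L.
    elim: IHgs => [|g gs' [Lg gL clg] _ [Lgs gsL clgs]].
      by exists [:: Evs [::]]; rewrite ?mem_head //; apply: closed_nodes_cons.
    exists (Evs (g :: gs') :: Lg ++ Lgs); first by rewrite mem_head.
    apply: closed_nodes_cons; first exact: closed_nodes_cat.
    apply/allP; rewrite /= !inE !mem_cat gL gsL !orbT //.
  exists (Ev (PComp f gs) :: Lf ++ Lgs); first by rewrite mem_head.
  apply: closed_nodes_cons; first exact: closed_nodes_cat.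
  by apply/allP; rewrite /= !inE !mem_cat fL gsL !orbT.
- move=> [Lf fL clf] [Lg gL clg].
  exists (Ev (PRec f g) :: Lf ++ Lg); first by rewrite mem_head.
  apply: closed_nodes_cons; first exact: closed_nodes_cat.
  by apply/allP; rewrite /= !inE !mem_cat fL gL eqxx !orbT.
- move=> [Lf fL clf].
  exists (Ev (PMu f) :: Below f :: Lf); first by rewrite mem_head.
  apply: closed_nodes_cons; first (apply: closed_nodes_cons => //).
    by apply/allP; rewrite /= !inE fL eqxx !orbT.
  by apply/allP; rewrite /= !inE fL eqxx !orbT.
Qed.

(** * Evaluation rules as tests *)

Definition tands := foldr TAnd TTop.

Lemma test_holds_tands h cs :
  test_holds h (tands cs) <-> forall c, List.In c cs -> test_holds h c.
Proof.
elim: cs => [|c cs IH] /=; first by [].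
rewrite IH; split=> [[hc hcs] c' [<-|/hcs]|hcs] //.
by split=> [|c' c'cs]; apply: hcs; [left|right].
Qed.

Section Rule.
Variable tag : node -> nat.

Definition is_node (c : node) x := TAt (tag c) 0 x.

(* Trace [1] is the conclusion of a derivation step, traces [2] and [3] are its
   premises. *)
Definition rule (c : node) : test :=
  match c with
  | Ev PZero => TAnd (TOne (res 0) 1) (TAt 0 (res 0) 1)
  | Ev PSucc => TAnd (TOne (arg 0) 1) (TSucc (res 0) 1 (arg 0) 1)
  | Ev (PProj i) => TAnd (TOne (arg i) 1) (TEq (res 0) 1 (arg i) 1)
  | Ev (PComp f gs) => tands
      [:: is_node (Evs gs) 2; TEqs false 0 2 false 0 1;
          is_node (Ev f) 3; TEqs false 0 3 true 0 2;
          TEq (res 0) 1 (res 0) 3]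
  | Ev (PRec f g) => TAnd (TOne (arg 0) 1) (TOr
      (tands [:: TAt 0 (arg 0) 1;
                 is_node (Ev f) 2; TEqs false 0 2 false 1 1;
                 TEq (res 0) 1 (res 0) 2])
      (tands [:: is_node (Ev (PRec f g)) 2;
                 TSucc (arg 0) 1 (arg 0) 2; TEqs false 1 2 false 1 1;
                 is_node (Ev g) 3; TEq (arg 0) 3 (arg 0) 2;
                 TEq (arg 1) 3 (res 0) 2; TEqs false 2 3 false 1 1;
                 TEq (res 0) 1 (res 0) 3]))
  | Ev (PMu f) => tands
      [:: TOne (res 0) 1;
          is_node (Below f) 2; TEq (arg 0) 2 (res 0) 1; TEqs false 1 2 false 0 1;
          is_node (Ev f) 3; TEqs false 0 3 false 0 2; TAt 0 (res 0) 3]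
  | Evs [::] => TNil true 0 1
  | Evs (g :: gs) => tands
      [:: is_node (Ev g) 2; TEqs false 0 2 false 0 1;
          TEq (res 0) 1 (res 0) 2;
          is_node (Evs gs) 3; TEqs false 0 3 false 0 1;
          TEqs true 1 1 true 0 3]
  | Below f => TAnd (TOne (arg 0) 1) (TOr (TAt 0 (arg 0) 1)
      (tands [:: is_node (Below f) 2;
                 TSucc (arg 0) 1 (arg 0) 2; TEqs false 1 2 false 1 1;
                 is_node (Ev f) 3; TEqs false 0 3 false 0 2;
                 TNot (TAt 0 (res 0) 3)]))
  end.

Definition rules (L : seq node) : test :=
  tands [seq TOr (TNot (is_node c 1)) (rule c) | c <- L].

Lemma test_holds_rules h L :
  test_holds h (rules L) <->
  forall c, c \in L -> h 1 0 (tag c) -> test_holds h (rule c).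
Proof.
rewrite test_holds_tands; split=> [hL c cL hc|hL c].
  have [//|//] : test_holds h (TOr (TNot (is_node c 1)) (rule c)).
  apply: hL; elim: L cL => //= a s IH; rewrite inE => /predU1P[->|/IH];
    by [left|right].
have {}hL c' : List.In c' L -> h 1 0 (tag c') -> test_holds h (rule c').
  move=> c'L; apply: hL; elim: L c'L => //= a s IH [->|/IH].
    exact: mem_head.
  by rewrite inE orbC => ->.
rewrite List.in_map_iff => -[c' [<- /hL c'L]] /=.
by case: (h 1 0 (tag c')) c'L => c'L; [right; apply: c'L|left].
Qed.

End Rule.

Definition quad (g0 g1 g2 g3 : nat -> nat -> bool) (x : nat) :=
  nth (fun _ _ => false) [:: g0; g1; g2; g3] x.
Arguments quad g0 g1 g2 g3 !x /.

Definition holds_val (g : nat -> nat -> bool) r (o : option nat) :=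
  forall p, g r p = (o == Some p).

(** Past the end [onth] is [None], so the registers there must be empty and a block also determines
    the length of its list. *)
Definition holds_seq (g : nat -> nat -> bool) b s (v : seq nat) :=
  forall i, holds_val g (rg b (s + i)) (onth v i).

Lemma holds_val_eq (g g' : nat -> nat -> bool) r r' o : (forall p, g r p = g' r' p) ->
  holds_val g' r' o -> holds_val g r o.
Proof. by move=> eq_g go p; rewrite eq_g. Qed.

Lemma holds_seq_eq (g g' : nat -> nat -> bool) b b' s s' v :
  (forall i p, g (rg b (s + i)) p = g' (rg b' (s' + i)) p) ->
  holds_seq g' b' s' v -> holds_seq g b s v.
Proof. by move=> eq_g gv i p; rewrite eq_g; apply: gv. Qed.

Lemma holds_seq_cons g b s x v :
  holds_seq g b s (x :: v) <->
  holds_val g (rg b s) (Some x) /\ holds_seq g b s.+1 v.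
Proof.
split=> [gv|[gx gv] [|i]]; last 2 first.
- by rewrite addn0.
- by rewrite -addSnnS; apply: gv.
by split=> [|i]; [have := gv 0; rewrite addn0|rewrite addSnnS; apply: (gv i.+1)].
Qed.

Lemma holds_val_fun g r k k' :
  holds_val g r (Some k) -> (forall p, g r p = (k' == p)) -> k' = k.
Proof. by move=> gk /(_ k); rewrite gk eqxx => /esym/eqP. Qed.

Lemma holds_seq_one g b v k :
  holds_seq g b 0 v -> (forall p, g (rg b 0) p = (k == p)) ->
  exists v', v = k :: v'.
Proof.
case: v => [|x v'] gv gk; first by have := gk k; rewrite (gv 0) eqxx.
have /holds_seq_cons[gx _] := gv.
by exists v'; rewrite (holds_val_fun gx gk).
Qed.

Lemma holds_val_succ (g g' : nat -> nat -> bool) r r' k :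
  (forall p, g r p = if p is p'.+1 then g' r' p' else false) ->
  holds_val g r (Some k) -> exists2 m, k = m.+1 & holds_val g' r' (Some m).
Proof.
move=> gS; case: k => [|m] gk; first by have := gS 0; rewrite gk.
by exists m => // p; have := gS p.+1; rewrite gk.
Qed.

(** * Soundness: sets closed under the rules contain only true facts *)

Section Sound.
Variables (tag : node -> nat) (L : seq node) (g0 : nat -> nat -> bool).
Variable G : (nat -> nat -> bool) -> Prop.
Hypothesis clL : closed_nodes L.
Hypothesis G_rules : forall g1, G g1 -> exists g2 g3, [/\ G g2, G g3 &
  test_holds (quad g0 g1 g2 g3) (rules tag L)].

Definition conclusion (c : node) (g : nat -> nat -> bool) (v : seq nat) : Prop :=
  match c with
  | Ev f => exists2 y, holds_val g (res 0) (Some y) & prf_eval f v y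
  | Evs gs => exists2 ws, holds_seq g true 0 ws & prf_evals gs v ws
  | Below f => exists m v', v = m :: v' /\
      forall l, l < m -> exists r, prf_eval f (l :: v') r.+1
  end.

(** The arguments [v] are assumed because registers of a trace in [G] may encode no list at all;
    premises get their arguments by copying from the conclusion. *)
Definition sound (c : node) := c \in L -> forall g v, G g -> g 0 (tag c) ->
  holds_seq g false 0 v -> conclusion c g v.

Lemma G_rule c g1 : c \in L -> G g1 -> g1 0 (tag c) ->
  exists g2 g3, [/\ G g2, G g3 & test_holds (quad g0 g1 g2 g3) (rule tag c)].
Proof.
move=> cL /G_rules[g2 [g3 [G2 G3 /test_holds_rules h]]] g1c.
by exists g2, g3; split=> //; apply: h.
Qed.

Lemma sound_Evs gs : List.Forall (fun g => sound (Ev g)) gs -> sound (Evs gs).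
Proof.
elim=> [|g gs' IHg _ IH] cL g1 v G1 g1c g1v;
  have [g2 [g3 [G2 G3 /= R]]] := G_rule cL G1 g1c.
  exists [::]; last exact: evs_nil.
  by move=> i p; rewrite onth0n R.
have [gL gsL] : Ev g \in L /\ Evs gs' \in L.
  by split; apply: (clL cL); rewrite /= !inE eqxx ?orbT.
case: R => [c2 [v2 [r1 [c3 [v3 [w1 _]]]]]].
have [y y2 Ey] := IHg gL _ _ G2 c2 (holds_seq_eq v2 g1v).
have [ws w3 Ews] := IH gsL _ _ G3 c3 (holds_seq_eq v3 g1v).
exists (y :: ws); last exact: evs_cons.
apply/holds_seq_cons; split; first exact: holds_val_eq r1 y2.
exact: holds_seq_eq w1 w3.
Qed.

Lemma sound_Below f : sound (Ev f) -> sound (Below f).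
Proof.
move=> IHf cL g1 v G1 g1c g1v.
(* The [TOne (arg 0)] in the rule excludes an empty argument list. *)
have [x [v' defv]] : exists x v', v = x :: v'.
  have [g2 [g3 [_ _ /= [[x x1] _]]]] := G_rule cL G1 g1c.
  by have [v' ->] := holds_seq_one g1v x1; exists x, v'.
exists x, v'; split=> //; move: g1v; rewrite {v}defv.
(* At first argument [m.+1], trace 2 covers the values below [m] and trace 3 the value [m]
   itself. *)
elim: x g1 G1 g1c => [|m IHm] g1 G1 g1c g1v //.
have [g2 [g3 [G2 G3 /= [_]]]] := G_rule cL G1 g1c.
have /holds_seq_cons[g1x g1v'] := g1v.
case=> [|[c2 [x2 [v2 [c3 [v3 [r3 _]]]]]]]; first by rewrite g1x.
have [_ [<-] g2x] := holds_val_succ x2 g1x.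
have g2v : holds_seq g2 false 0 (m :: v').
  by apply/holds_seq_cons; split=> //; apply: holds_seq_eq v2 g1v'.
move=> l; rewrite ltnS leq_eqVlt => /predU1P[->|]; last exact: (IHm g2).
have fL : Ev f \in L by apply: (clL cL); rewrite /= !inE eqxx orbT.
have [[|r] y3 Ey] := IHf fL _ _ G3 c3 (holds_seq_eq v3 g2v).
  by case: r3; rewrite y3.
by exists r.
Qed.

(** A priori the premises in [G] could form infinite or circular chains. Induction on the program
    excludes this, with an inner induction on the first argument for [PRec], whose rule refers back
    to the same program. *)
Lemma sound_Ev f : sound (Ev f).
Proof.
elim/prf_nested_ind: f => [||i|f gs IHf IHgs|f g IHf IHg|f IHf] cL g1 v G1 g1c g1v.
- have [g2 [g3 [_ _ /= [[y y1] y0]]]] := G_rule cL G1 g1c.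
  move: y0; rewrite y1 => /eqP y0; rewrite y0 in y1.
  by exists 0 => //; apply: ev_zero.
- have [g2 [g3 [_ _ /= [[x x1] y1]]]] := G_rule cL G1 g1c.
  have [v' defv] := holds_seq_one g1v x1; rewrite defv.
  exists x.+1; last exact: ev_succ.
  by move=> [|p]; rewrite y1 // x1.
- have [g2 [g3 [_ _ /= [[x x1] y1]]]] := G_rule cL G1 g1c.
  have xi : onth v i = Some x by apply/eqP; rewrite -(g1v i) x1.
  exists x; first by move=> p; rewrite y1 x1.
  rewrite -(onth_nth 0 _ _ _ xi); apply: ev_proj.
  by rewrite -onthTE xi.
- have [g2 [g3 [G2 G3 /= [c2 [v2 [c3 [v3 [r1 _]]]]]]]] := G_rule cL G1 g1c.
  have [fL gsL] : Ev f \in L /\ Evs gs \in L.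
    by split; apply: (clL cL); rewrite /= !inE eqxx ?orbT.
  have [ws w2 Ews] := sound_Evs IHgs gsL G2 c2 (holds_seq_eq v2 g1v).
  have [y y3 Ey] := IHf fL _ _ G3 c3 (holds_seq_eq v3 w2).
  exists y; last exact: ev_comp Ews Ey.
  exact: holds_val_eq r1 y3.
- have [x [v' defv]] : exists x v', v = x :: v'.
    have [g2 [g3 [_ _ /= [[x x1] _]]]] := G_rule cL G1 g1c.
    by have [v' ->] := holds_seq_one g1v x1; exists x, v'.
  have [fL gL] : Ev f \in L /\ Ev g \in L.
    by split; apply: (clL cL); rewrite /= !inE eqxx ?orbT.
  rewrite {v}defv in g1v *.
  elim: x g1 G1 g1c g1v => [|m IHm] g1 G1 g1c g1v;
    have /holds_seq_cons[g1x g1v'] := g1v;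
    have [g2 [g3 [G2 G3 /= [_]]]] := G_rule cL G1 g1c.
  + case=> [[_ [c2 [v2 [r1 _]]]]|[_ [x2 _]]]; last first.
      by have [] := holds_val_succ x2 g1x.
    have [y y2 Ey] := IHf fL _ _ G2 c2 (holds_seq_eq v2 g1v').
    exists y; last exact: ev_rec0.
    exact: holds_val_eq r1 y2.
  + case=> [[]|[c2 [x2 [v2 [c3 [x3 [z3 [v3 [r1 _]]]]]]]]]; first by rewrite g1x.
    have [_ [<-] g2x] := holds_val_succ x2 g1x.
    have g2v : holds_seq g2 false 0 (m :: v').
      by apply/holds_seq_cons; split=> //; apply: holds_seq_eq v2 g1v'.
    have [z z2 Ez] := IHm _ G2 c2 g2v.
    have g3v : holds_seq g3 false 0 [:: m, z & v'].
      apply/holds_seq_cons; split; first exact: holds_val_eq x3 g2x.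
      apply/holds_seq_cons; split; first exact: holds_val_eq z3 z2.
      exact: holds_seq_eq v3 g1v'.
    have [y y3 Ey] := IHg gL _ _ G3 c3 g3v.
    exists y; last exact: ev_recS Ez Ey.
    exact: holds_val_eq r1 y3.
- have [g2 [g3 [G2 G3 /= [[m m1] [c2 [x2 [v2 [c3 [v3 [r3 _]]]]]]]]]] :=
    G_rule cL G1 g1c.
  have [fL bL] : Ev f \in L /\ Below f \in L.
    by split; apply: (clL cL); rewrite /= !inE eqxx ?orbT.
  have g2v : holds_seq g2 false 0 (m :: v).
    apply/holds_seq_cons; split; last exact: holds_seq_eq v2 g1v.
    by move=> p; rewrite x2 m1.
  (* Trace 2 certifies positivity below the candidate [m], trace 3 the zero at [m]. *)
  have [m' [v' [[<- <-] below]]] := sound_Below IHf bL G2 c2 g2v.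
  have [y y3 Ey] := IHf fL _ _ G3 c3 (holds_seq_eq v3 g2v).
  exists m; first by move=> p; rewrite m1.
  apply: ev_mu below.
  by move: r3; rewrite y3 => /eqP[<-].
Qed.

End Sound.

(** * Completeness: true facts of bounded size are closed under premises *)

Fixpoint prf_height (f : prf) : nat :=
  match f with
  | PComp f gs => (prf_height f + (sumn (map prf_height gs) + size gs)).+1
  | PRec f g => (prf_height f + prf_height g).+1
  | PMu f => (prf_height f).+1
  | _ => 1
  end.

Lemma prf_height_gt0 f : 0 < prf_height f.
Proof. by case: f. Qed.

(* Bounds by how much the argument lists can grow in a derivation below a
   node, so that finitely many registers suffice. *)
Definition height (c : node) : nat :=
  match c with
  | Ev f | Below f => prf_height f
  | Evs gs => sumn (map prf_height gs) + size gs
  end.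

Definition derivable (c : node) (v ws : seq nat) : Prop :=
  match c with
  | Ev f => exists2 y, ws = [:: y] & prf_eval f v y
  | Evs gs => prf_evals gs v ws
  | Below f => exists m v', [/\ v = m :: v', ws = [::] &
      forall l, l < m -> exists r, prf_eval f (l :: v') r.+1]
  end.

Lemma size_prf_evals gs v ws : prf_evals gs v ws -> size ws = size gs.
Proof.
elim: gs ws => [|g gs IH] ws H; inversion H as [|? ? ? w ws' _ H']; subst => //=.
by rewrite (IH _ H').
Qed.

Lemma size_derivable K c v ws :
  derivable c v ws -> size v + height c <= K -> size ws <= K.
Proof.
case: c => [f [y -> _]|gs /size_prf_evals ->|f [m [v' [_ -> _]]]] //= le_K.
  apply: leq_trans le_K; apply: leq_trans (leq_addl _ _).
  exact: prf_height_gt0.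
by rewrite addnA in le_K; apply: leq_trans le_K; rewrite leq_addl.
Qed.

Section Complete.
Variables (tag : node -> nat) (L : seq node) (K : nat).
Hypothesis clL : closed_nodes L.
Hypothesis tag_inj : {in L &, injective tag}.

Definition fact (c : node) (v ws : seq nat) (r p : nat) : bool :=
  (if r is r'.+1 then onth (if odd r' then ws else v) r'./2 else Some (tag c))
  == Some p.

Lemma fact_rg c v ws b i p :
  fact c v ws (rg b i) p = (onth (if b then ws else v) i == Some p).
Proof. by rewrite /fact /rg half_bit_double oddD odd_double addbF oddb. Qed.

(** The quantity [size v + height c] never increases from a conclusion to its premises, so the bound
    by [K] is inherited along derivations. *)
Definition facts (g : nat -> nat -> bool) : Prop :=
  exists c v ws, [/\ c \in L, derivable c v ws, size v + height c <= K &
                     g = fact c v ws].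

Lemma facts_Ev f v y : Ev f \in L -> prf_eval f v y ->
  size v + prf_height f <= K -> facts (fact (Ev f) v [:: y]).
Proof. by move=> fL E le_K; exists (Ev f), v, [:: y]; split=> //; exists y. Qed.

Lemma fact_one c v ws b i x : onth (if b then ws else v) i = Some x ->
  exists k, forall p, fact c v ws (rg b i) p = (k == p).
Proof. by move=> vi; exists x => p; rewrite fact_rg vi. Qed.

(** [g0] is arbitrary since the rules mention only traces 1 to 3. Where a rule has fewer than two
    premises, a fact already at hand fills the gap. *)
Lemma facts_rule g0 c v ws :
  c \in L -> derivable c v ws -> size v + height c <= K ->
  exists g2 g3, [/\ facts g2, facts g3 &
    test_holds (quad g0 (fact c v ws) g2 g3) (rule tag c)].
Proof.
move=> cL D le_K.
have G1 : facts (fact c v ws) by exists c, v, ws.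
have tagE c' v' ws' : fact c' v' ws' 0 (tag c') by apply/eqP.
case: c => [[||i|f gs|f g|f]|[|g gs]|f] in cL D le_K G1 *.
- case: D => y defws E; inversion E; subst.
  exists (fact (Ev PZero) v [:: 0]), (fact (Ev PZero) v [:: 0]); split=> //=.
  by split; [apply: fact_one|rewrite fact_rg].
- case: D => y defws E; inversion E as [|x v'| | | | |]; subst.
  set g := fact _ _ _ in G1 *; exists g, g; split=> //=.
  split; first exact: fact_one.
  by move=> [|p]; rewrite /g !fact_rg.
- case: D => y defws E; inversion E as [| |j v' lt_i| | | |]; subst.
  have vi : onth v i = Some (nth 0 v i).
    by rewrite onthE (nth_map 0).
  set g := fact _ _ _ in G1 *; exists g, g; split=> //=.
  split=> [|p]; first by apply: fact_one; exact: vi.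
  by rewrite /g !fact_rg vi.
- have [fL gsL] : Ev f \in L /\ Evs gs \in L.
    by split; apply: (clL cL); rewrite /= !inE eqxx ?orbT.
  case: D => y defws E; inversion E as [| | |? ? ? zs ? Ezs Ey| | |]; subst.
  rewrite /= in le_K.
  exists (fact (Evs gs) v zs), (fact (Ev f) zs [:: y]).
  split; [exists (Evs gs), v, zs; split=> //| |].
  + apply: leq_trans le_K; rewrite leq_add2l; apply: leqW; exact: leq_addl.
  + apply: facts_Ev => //; rewrite (size_prf_evals Ezs) addnC.
    apply: leq_trans le_K; apply: leq_trans (leq_addl _ _); apply: leqW.
    by rewrite leq_add2l leq_addl.
  + by repeat split; move=> *; rewrite /= ?fact_rg ?tagE.
- have [fL gL] : Ev f \in L /\ Ev g \in L.
    by split; apply: (clL cL); rewrite /= !inE eqxx ?orbT.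
  case: D => y defws E; rewrite /= in le_K.
  inversion E as [| | | |? ? v' ? Ey|? ? m v' r ? Er Ey|]; subst.
  + exists (fact (Ev f) v' [:: y]), (fact (Ev f) v' [:: y]).
    have G2 : facts (fact (Ev f) v' [:: y]).
      apply: facts_Ev => //; apply: leq_trans le_K.
      by rewrite leq_add ?leqnSn // leqW // leq_addr.
    split=> //=; split; first by apply: fact_one.
    by left; repeat split; move=> *; rewrite /= ?fact_rg ?tagE.
  + exists (fact (Ev (PRec f g)) (m :: v') [:: r]).
    exists (fact (Ev g) [:: m, r & v'] [:: y]).
    split=> /=; [exact: facts_Ev| |].
      (* [g] takes one more argument than [PRec f g]; the successor in [prf_height] pays for it. *)
      apply: facts_Ev => //; apply: leq_trans le_K => /=.
      by rewrite addSnnS leq_add2l ltnS leq_addl.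
    split; first by apply: fact_one.
    by right; repeat split; try case; move=> *; rewrite /= ?fact_rg ?tagE.
- have [fL bL] : Ev f \in L /\ Below f \in L.
    by split; apply: (clL cL); rewrite /= !inE eqxx ?orbT.
  case: D => y defws E; inversion E as [| | | | | |? ? ? E0 below]; subst.
  rewrite /= in le_K.
  exists (fact (Below f) (y :: v) [::]), (fact (Ev f) (y :: v) [:: 0]).
  split.
  + by exists (Below f), (y :: v), [::]; split; rewrite //= ?addSnnS //; exists y, v.
  + by apply: facts_Ev; rewrite //= addSnnS.
  + split; first by apply: fact_one.
    by repeat split; move=> *; rewrite /= ?fact_rg ?tagE.
- set h := fact _ _ _ in G1 *; exists h, h; split=> //= i p.
  by inversion D; subst; rewrite /h fact_rg onth0n.
- have [gL gsL] : Ev g \in L /\ Evs gs \in L.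
    by split; apply: (clL cL); rewrite /= !inE eqxx ?orbT.
  inversion D as [|? ? ? y zs Ey Ezs]; subst; rewrite /= in le_K.
  exists (fact (Ev g) v [:: y]), (fact (Evs gs) v zs); split.
  + apply: facts_Ev => //; apply: leq_trans le_K; rewrite leq_add2l -addnA.
    exact: leq_addr.
  + exists (Evs gs), v, zs; split=> //; apply: leq_trans le_K.
    by rewrite leq_add2l /= addnS -addnA; apply: leqW; apply: leq_addl.
  + by repeat split; move=> *; rewrite /= ?fact_rg ?tagE.
- have [fL _] : Ev f \in L /\ Below f \in L.
    by split; apply: (clL cL); rewrite /= !inE eqxx ?orbT.
  case: D => m [v' [defv defws below]]; subst; rewrite /= in le_K.
  case: m => [|m] in below G1 *.
    set h := fact _ _ _ in G1 *; exists h, h; split=> //=.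
    by split; [apply: fact_one|left; rewrite /h fact_rg].
  have [r Er] := below m (ltnSn m).
  exists (fact (Below f) (m :: v') [::]), (fact (Ev f) (m :: v') [:: r.+1]).
  split.
  + exists (Below f), (m :: v'), [::]; split=> //; exists m, v'; split=> // l lm.
    exact/below/ltnW.
  + exact: facts_Ev.
  + split; first by apply: fact_one.
    by right; repeat split; try case; move=> *; rewrite /= ?fact_rg ?tagE.
Qed.

(** Tags are injective on [L], so a fact activates only the rule of its own node. *)
Lemma facts_rules g0 g1 : facts g1 -> exists g2 g3, [/\ facts g2, facts g3 &
  test_holds (quad g0 g1 g2 g3) (rules tag L)].
Proof.
move=> [c [v [ws [cL D le_K ->]]]].
have [g2 [g3 [G2 G3 R]]] := facts_rule g0 cL D le_K.
exists g2, g3; split=> //; apply/test_holds_rules => c' c'L /eqP[/tag_inj].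
by move=> <-.
Qed.

End Complete.

(** * The formula attached to a program *)

Definition mk_trace n (g : nat -> nat -> bool) : trace n :=
  fun p => [set j : 'I_n | g (val j) p].

Lemma has_at_mk_trace n g r p : has_at (mk_trace n g) r p = (r < n) && g r p.
Proof.
apply/existsP/andP=> [[j /andP[/eqP <-]]|[lt_r gr]].
  by rewrite inE => ->; split=> //; apply: ltn_ord.
by exists (Ordinal lt_r); rewrite inE /= eqxx.
Qed.

(** Cutting down to a finite alphabet loses nothing: both lists of the fact have length at most [K],
    so all registers beyond are empty anyway. *)
Lemma has_at_fact tag L K g : facts tag L K g ->
  has_at (mk_trace K.*2.+3 g) = g.
Proof.
move=> [c [v [ws [_ D le_K ->]]]].
apply: functional_extensionality => r; apply: functional_extensionality => p.
rewrite has_at_mk_trace; case: ltnP => //=.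
case: r => // r; rewrite ltnS => le_r; apply/esym/negbTE.
rewrite /fact onth_default //; apply: (@leq_trans K).
  case: ifP => _; first exact: size_derivable le_K.
  exact: leq_trans (leq_addr _ _) le_K.
by apply: leq_trans (half_leq le_r); rewrite /= doubleK.
Qed.

(** Negated so that, by De Morgan, the body of [query] asserts that the inputs hold; the code is a
    plain iteration in [x]. *)
Definition num (b : nat) (x : nat) := iter x LNext (LNeg (LAtom b 0)).

(* The program enters only through [p], the inputs only through [num]. *)
Definition query (p : ltl) (x y : nat) : hltl :=
  HEx 0 (HAll 1 (HEx 2 (HEx 3 (HBody
    (LNeg (LOr p (LOr (num (arg 0) x) (num (arg 1) y)))))))).

(** The two arguments must be single numbers but are left open, so this test depends on the program
    alone; [query] pins their values. *)
Definition start (tag : node -> nat) (f : prf) : test := tands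
  [:: is_node tag (Ev f) 0; TOne (arg 0) 0; TOne (arg 1) 0; TNil false 2 0;
      TOne (res 0) 0; TAt 1 (res 0) 0].

Lemma sat_query n T c x y :
  hlang (query (LNeg (ltl_of n c)) x y) T <->
  exists t0 : trace n, T t0 /\ forall t1, T t1 ->
  exists t2, T t2 /\ exists t3, T t3 /\
    [/\ test_holds (quad (has_at t0) (has_at t1) (has_at t2) (has_at t3)) c,
        has_at t0 (arg 0) x & has_at t0 (arg 1) y].
Proof.
rewrite /hlang /=.
have bodyE (t0 t1 t2 t3 : trace n) :
    let e := upd (upd (upd (upd (fun _ => None) 0 t0) 1 t1) 2 t2) 3 t3 in
    ~ (~ sat_ltl e 0 (ltl_of n c) \/
       (sat_ltl e 0 (num (arg 0) x) \/ sat_ltl e 0 (num (arg 1) y))) <->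
    [/\ test_holds (quad (has_at t0) (has_at t1) (has_at t2) (has_at t3)) c,
        has_at t0 (arg 0) x & has_at t0 (arg 1) y].
  move=> e; rewrite sat_ltl_of; last by case=> [|[|[|[|]]]].
  have -> : env_at e = quad (has_at t0) (has_at t1) (has_at t2) (has_at t3).
    apply: functional_extensionality => z; apply: functional_extensionality => r.
    apply: functional_extensionality => p.
    by case: z => [|[|[|[|z]]]] //=; rewrite nth_nil.
  have numE b z : sat_ltl e 0 (num b z) <-> ~ has_at t0 b z.
    by rewrite sat_next addn0.
  rewrite !numE; split=> [h|[hc hx hy] [/(_ hc)|[/(_ hx)|/(_ hy)]] //].
  split; apply: NNPP => h'; apply: h.
  - by left.
  - by right; left.
  - by right; right.
split=> -[t0 [T0 h]]; exists t0; split=> // t1 /h[t2 [T2 [t3 [T3 b]]]];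
  by exists t2; split=> //; exists t3; split=> //; apply/bodyE.
Qed.

(** [n] and [p] come before [x] and [y], so that the inputs can later be [n] and the code of [p]
    themselves. *)
Lemma query_spec f : exists n p, forall x y, closed_over n (query p x y) /\
  ((exists T : traceset n, hlang (query p x y) T) <-> prf_eval f [:: x; y] 1).
Proof.
have [L fL clL] := closed_nodes_ex f.
pose tag c := index c L.
have tag_inj : {in L &, injective tag}.
  by move=> c c' cL c'L /(congr1 (nth c L)); rewrite !nth_index.
(* The 2 accounts for the arguments [x] and [y] of the start fact. *)
pose K := (prf_height f).+2; pose n := K.*2.+3.
pose c := TAnd (start tag f) (rules tag L).
exists n, (LNeg (ltl_of n c)) => x y; split.
  have numP b z : b < n -> ltl_ok n [:: 3; 2; 1; 0] (num b z).
    by move=> bn; elim: z => [|z IH] //=; rewrite bn.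
  pose ok := ltl_ok n [:: 3; 2; 1; 0].
  rewrite -[closed_over _ _]/[&& ok (ltl_of n c), ok (num 1 x) & ok (num 3 y)].
  by rewrite /ok ltl_ok_of ?numP.
split=> [[T /sat_query[t0 [T0 h]]]|E].
  (* [start] speaks of [t0] only, so any instance of the universal quantifier yields it, and [t0]
     itself is available. *)
  have [t2 [T2 [t3 [T3 [[/= start0 _] x0 y0]]]]] := h _ T0.
  move: start0 => [tag0 [[x' x1] [[y' y1] [nil0 [[z z1] [z0 _]]]]]].
  move: x0 y0 z0; rewrite x1 y1 z1 => /eqP defx /eqP defy /eqP defz; subst x' y' z.
  have t0v : holds_seq (has_at t0) false 0 [:: x; y].
    apply/holds_seq_cons; split=> //; apply/holds_seq_cons; split=> //.
    by move=> i p; rewrite nil0 onth0n.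
  pose G g := exists2 t, T t & g = has_at t.
  have G_rules g1 : G g1 -> exists g2 g3, [/\ G g2, G g3 &
      test_holds (quad (has_at t0) g1 g2 g3) (rules tag L)].
    move=> [t1 /h[t [Tt [t' [Tt' [[_ R] _ _]]]]] ->].
    by exists (has_at t), (has_at t'); split=> //; [exists t|exists t'].
  have G0 : G (has_at t0) by exists t0.
  have [z z0 Ez] := sound_Ev clL G_rules fL G0 tag0 t0v.
  by move: (z0 1); rewrite z1 eqxx => /esym/eqP[defz]; rewrite defz in Ez.
(* The model consists of all true facts within the bound [K]. *)
pose T t := exists2 g, facts tag L K g & t = mk_trace n g.
exists T; apply/sat_query.
pose g0 := fact tag (Ev f) [:: x; y] [:: 1].
have G0 : facts tag L K g0 by apply: facts_Ev.
exists (mk_trace n g0); split; first by exists g0.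
move=> _ [g1 G1 ->]; have [g2 [g3 [G2 G3 R]]] := facts_rules clL tag_inj g0 G1.
exists (mk_trace n g2); split; first by exists g2.
exists (mk_trace n g3); split; first by exists g3.
rewrite !(has_at_fact G0) !(has_at_fact G1) (has_at_fact G2) (has_at_fact G3).
split; rewrite /g0 ?fact_rg //; split=> //=.
repeat split; rewrite ?fact_rg //.
- exact/eqP.
- exact: fact_one.
- exact: fact_one.
- by move=> i p; rewrite fact_rg /= onth0n.
- exact: fact_one.
Qed.

(** * Computability of the reduction *)

Definition computable1 (h : nat -> nat) :=
  exists q, forall x, prf_eval q [:: x] (h x).
Definition computable2 (h : nat -> nat -> nat) :=
  exists q, forall x y, prf_eval q [:: x; y] (h x y).

Lemma prf_evals1 g v w : prf_eval g v w -> prf_evals [:: g] v [:: w].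
Proof. by move=> E; apply: evs_cons E _; apply: evs_nil. Qed.

Lemma prf_evals2 g g' v w w' : prf_eval g v w -> prf_eval g' v w' ->
  prf_evals [:: g; g'] v [:: w; w'].
Proof. by move=> E E'; apply: evs_cons E _; apply: prf_evals1. Qed.

Lemma prf_const c : exists q, forall v, prf_eval q v c.
Proof.
elim: c => [|c [q Eq]]; first by exists PZero => v; apply: ev_zero.
exists (PComp PSucc [:: q]) => v.
by apply: ev_comp (prf_evals1 (Eq v)) _; apply: ev_succ.
Qed.

Lemma computable2_const c : computable2 (fun _ _ => c).
Proof. by have [q Eq] := prf_const c; exists q. Qed.

Lemma computable2_fst : computable2 (fun x _ => x).
Proof. by exists (PProj 0) => x y; apply: (@ev_proj 0 [:: x; y]). Qed.

Lemma computable2_snd : computable2 (fun _ y => y).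
Proof. by exists (PProj 1) => x y; apply: (@ev_proj 1 [:: x; y]). Qed.

Lemma computable2_comp1 h g : computable1 h -> computable2 g ->
  computable2 (fun x y => h (g x y)).
Proof.
move=> [p Ep] [q Eq]; exists (PComp p [:: q]) => x y.
exact: ev_comp (prf_evals1 (Eq x y)) (Ep _).
Qed.

Lemma computable2_comp2 h g g' :
  computable2 h -> computable2 g -> computable2 g' ->
  computable2 (fun x y => h (g x y) (g' x y)).
Proof.
move=> [p Ep] [q Eq] [q' Eq']; exists (PComp p [:: q; q']) => x y.
exact: ev_comp (prf_evals2 (Eq x y) (Eq' x y)) (Ep _ _).
Qed.

Lemma computable1_succ : computable1 succn.
Proof. by exists PSucc => x; apply: ev_succ. Qed.

Lemma computable1_iteri a h :
  computable2 h -> computable1 (fun x => iteri x h a).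
Proof.
move=> [p Ep]; have [q Eq] := prf_const a; exists (PRec q p).
by elim=> [|x IH]; [apply: ev_rec0|apply: ev_recS IH (Ep _ _)].
Qed.

Lemma computable2_add : computable2 addn.
Proof.
exists (PRec (PProj 0) (PComp PSucc [:: PProj 1])) => x y.
elim: x => [|x IH]; first by apply: ev_rec0; apply: (@ev_proj 0 [:: y]).
apply: ev_recS IH _; apply: ev_comp (prf_evals1 _) (ev_succ _ _).
exact: (@ev_proj 1 [:: x; x + y; y]).
Qed.

(** Replaces the division in [cpair] by a primitive recursion. *)
Lemma triangular_iteri s : s * s.+1 %/ 2 = iteri s (fun i r => r + i.+1) 0.
Proof.
elim: s => [|s /= <-] //.
by rewrite mulnC -[s.+2]addn2 mulnDl [2 * _]mulnC addnC divnMDl // addnC.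
Qed.

Lemma computable2_cpair : computable2 cpair.
Proof.
have [q Eq] : computable2 (fun x y =>
    iteri (x + y) (fun i r => r + i.+1) 0 + y).
  apply: computable2_comp2 computable2_add _ computable2_snd.
  apply: (computable2_comp1 (h := fun s => iteri s _ 0)) computable2_add.
  apply: (computable1_iteri 0 (h := fun i r => r + i.+1)).
  apply: computable2_comp2 computable2_add computable2_snd _.
  exact: computable2_comp1 computable1_succ computable2_fst.
by exists q => x y; rewrite /cpair triangular_iteri.
Qed.

Lemma enc_num b x :
  enc_ltl (num b x) = iteri x (fun _ => cpair 3) (enc_ltl (num b 0)).
Proof. by elim: x => //= x ->. Qed.

(** [n] serves as alphabet size and as first input, [enc_ltl p] as part of the formula code and as
    second input. This double use is the self-reference of the diagonal argument. *)
Lemma computable_query : exists q, forall n p,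
  prf_eval q [:: n; enc_ltl p] (enc_instance n (query p n (enc_ltl p)) 0).
Proof.
have pairC g g' : computable2 g -> computable2 g' ->
    computable2 (fun x y => cpair (g x y) (g' x y)).
  exact: computable2_comp2 computable2_cpair.
have numC b : computable1 (fun x => enc_ltl (num b x)).
  have [q Eq] : computable1 (fun x =>
      iteri x (fun _ => cpair 3) (enc_ltl (num b 0))).
    apply: computable1_iteri; apply: pairC computable2_snd.
    exact: computable2_const.
  by exists q => x; rewrite enc_num.
pose bodyC x y := cpair 1 (cpair 2 (cpair y (cpair 2
  (cpair (enc_ltl (num (arg 0) x)) (enc_ltl (num (arg 1) y)))))).
have [q Eq] : computable2 (fun x y => cpair x (cpair
    (cpair 0 (cpair 0 (cpair 1 (cpair 1 (cpair 0 (cpair 2 (cpair 0 (cpair 3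
      (cpair 2 (bodyC x y)))))))))) 0)).
  rewrite /bodyC; repeat first [exact: computable2_const | apply: (pairC)].
  - exact: computable2_fst.
  - exact: computable2_snd.
  - exact: computable2_comp1 (numC _) computable2_fst.
  - exact: computable2_comp1 (numC _) computable2_snd.
by exists q => n p; apply: Eq.
Qed.

(** * 0-safety and the diagonal argument *)

Lemma k_safety_false n k (S : hyperprop n) : (forall T, ~ S T) -> k_safety k S.
Proof. by move=> S0 T _; exists [::]; split=> // T' _; apply: S0. Qed.

(** A bad set of size 0 is empty, hence lies below every trace set and rejects them all. *)
Lemma k_safety0 n (S : hyperprop n) T0 :
  ~ S T0 -> k_safety 0 S -> forall T, ~ S T.
Proof.
move=> nS0 /(_ _ nS0)[U [badU [size0 _]]] T; apply: badU => u.
by rewrite -mem_undup; case: (undup U) size0.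
Qed.

(* No partial recursive function decides, on (codes of) instances (AP = 'I_n,
   closed HyperLTL formula phi over AP, k), whether L(phi) is a k-safety
   hyperproperty. *)
Theorem theorem13 :
  ~ exists f : prf,
      forall (n : nat) (phi : hltl) (k : nat),
        closed_over n phi ->
        (k_safety k (@hlang n phi) -> prf_eval f [:: enc_instance n phi k] 1) /\
        (~ k_safety k (@hlang n phi) -> prf_eval f [:: enc_instance n phi k] 0).
Proof.
move=> [f f_dec]; have [q Eq] := computable_query.
pose d := PComp f [:: q].
have [n [p /(_ n (enc_ltl p))[ok_phi sat_phi]]] := query_spec d.
set phi := query p n (enc_ltl p) in ok_phi sat_phi.
have [yes no] := f_dec n phi 0 ok_phi.
(* [d] returns what [f] answers on the instance built from its inputs, and on these inputs that
   instance is [phi] with [k = 0]. *)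
have run y : prf_eval f [:: enc_instance n phi 0] y ->
    prf_eval d [:: n; enc_ltl p] y.
  exact: ev_comp (prf_evals1 (Eq n p)).
have empty_unsat : ~ hlang phi (fun _ : trace n => False) by case=> t [].
case: (classic (k_safety 0 (@hlang n phi))) => [safe|unsafe].
  (* The answer 1 makes [phi] satisfiable, whereas 0-safety makes it unsatisfiable. *)
  have /sat_phi[T] := run _ (yes safe).
  exact: k_safety0 empty_unsat safe T.
have sat : exists T : traceset n, hlang phi T.
  apply: NNPP => unsat; apply: unsafe; apply: k_safety_false => T satT.
  by apply: unsat; exists T.
(* Satisfiability gives [d] the value 1, while [f] answered 0. *)
by have := prf_eval_det (run _ (no unsafe)) (proj1 sat_phi sat).
Qed.
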